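(* Let $t\ge1$ be an integer, $N=(t+1)^2$, $\tau=\sqrt{\frac{2t+1}{4\pi}}\,(t+1)^3$, and let $\mathbb{X}_N=\{[\mathbf{x}]_i=\mathcal{C}(\hat{\mathbf{x}}_i,\gamma_i),\ i=1,\ldots,N\}$ be a set of spherical caps on $\mathbb{S}^2$ with set of center points $\hat X_N=\{\hat{\mathbf{x}}_1,\ldots,\hat{\mathbf{x}}_N\}$. Assume that (i) there exists a spherical $t$-design $X_N^0\in\mathbb{X}_N$, and (ii) $\mathbf{Y}(\hat X_N)$ is nonsingular. Then any point set $X_N\in\mathbb{X}_N$ is a fundamental (with order $t$) spherical $t_\epsilon$-design with $$\frac{2\tau\,\mathrm{rad}(\mathbb{X}_N)\|\mathbf{Y}(\hat X_N)^{-1}\|_1}{1-4\tau\,\mathrm{rad}(\mathbb{X}_N)\|\mathbf{Y}(\hat X_N)^{-1}\|_1}\le\epsilon<1,$$ if $$\mathrm{rad}(\mathbb{X}_N)<\min\left(\frac14\rho(\mathbb{X}_N),\ \frac{\epsilon}{2(1+2\epsilon)\tau\|\mathbf{Y}(\hat X_N)^{-1}\|_1}\right).$$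
   Context: $\mathbb{S}^2$ is the unit sphere in $\mathbb{R}^3$ with surface measure $\mathrm{d}\omega$, $|\mathbb{S}^2|=4\pi$; the points of a point set are distinct. $\mathrm{dist}(\mathbf{x},\mathbf{y})=\cos^{-1}(\mathbf{x}\cdot\mathbf{y})$, and $\mathcal{C}(\hat{\mathbf{x}},\gamma)=\{\mathbf{x}\in\mathbb{S}^2:\cos^{-1}(\mathbf{x}\cdot\hat{\mathbf{x}})\le\gamma\}$ for $\hat{\mathbf{x}}\in\mathbb{S}^2$, $\gamma>0$. For $\mathbb{X}_N=\{[\mathbf{x}]_i=\mathcal{C}(\hat{\mathbf{x}}_i,\gamma_i)\}_{i=1}^N$: $\mathrm{rad}(\mathbb{X}_N)=\max_{1\le i\le N}\gamma_i$; $\rho(\mathbb{X}_N)=\min\{\mathrm{dist}(\mathbf{x}_i,\mathbf{x}_j): i\ne j,\ \mathbf{x}_i\in[\mathbf{x}]_i,\ \mathbf{x}_j\in[\mathbf{x}]_j\}$. For a point set $X_N=\{\mathbf{x}_1,\ldots,\mathbf{x}_N\}$, $X_N\in\mathbb{X}_N$ means $\mathbf{x}_i\in[\mathbf{x}]_i$ and $\mathbf{x}_i\notin[\mathbf{x}]_j$ for all $i=1,\ldots,N$ and $j\ne i$. A spherical polynomial of degree $\le t$ is the restriction to $\mathbb{S}^2$ of a real polynomial in three variables of degree $\le t$; their space is $\mathbb{P}_t$, of dimension $(t+1)^2$. A set $X_N=\{\mathbf{x}_1,\ldots,\mathbf{x}_N\}\subset\mathbb{S}^2$ is a spherical $t$-design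 if $\frac1N\sum_{j=1}^N p(\mathbf{x}_j)=\frac1{4\pi}\int_{\mathbb{S}^2}p\,\mathrm{d}\omega$ for all $p\in\mathbb{P}_t$. For $0\le\epsilon<1$, it is a spherical $t_\epsilon$-design if there are weights $\mathbf{w}=(w_1,\ldots,w_N)^T$ with $\frac{4\pi}{N}(1-\epsilon)\le w_i\le\frac{4\pi}{N}(1-\epsilon)^{-1}$ for $i=1,\ldots,N$, such that $\sum_{i=1}^N w_i p(\mathbf{x}_i)=\int_{\mathbb{S}^2}p\,\mathrm{d}\omega$ for all $p\in\mathbb{P}_t$. $X_N$ is fundamental with order $t$ if the zero polynomial is the only element of $\mathbb{P}_t$ vanishing at every point of $X_N$. $\{Y_{\ell,k}:\ell\ge0,\ k=1,\ldots,2\ell+1\}$ is a fixed real spherical harmonic basis ($Y_{\ell,k}$ of degree $\ell$), orthonormal in $\mathbb{L}_2(\mathbb{S}^2)$. $\mathbf{Y}(X_N)\in\mathbb{R}^{N\times(t+1)^2}$ has entries $\mathbf{Y}_{i,\ell^2+k}(X_N)=Y_{\ell,k}(\mathbf{x}_i)$, $i=1,\ldots,N$, $k=1,\ldots,2\ell+1$, $\ell=0,\ldots,t$; it is square since $N=(t+1)^2$. The matrix norm $\|\cdot\|_1$ is the maximum absolute column sum. *)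

(* Defs.v *)
(* The notations of [mpoly] clash with those of MathComp-Analysis: only its
   canonical structures and coercions are imported. *)
From mathcomp Require Import all_boot all_order all_algebra.
From mathcomp Require Import all_classical all_reals all_analysis.
From mathcomp Require mpoly.
Import (canonicals, coercions) mpoly.

Set Implicit Arguments.
Unset Strict Implicit.
Unset Printing Implicit Defensive.

Import Order.TTheory GRing.Theory Num.Theory.

Local Open Scope classical_set_scope.
Local Open Scope ring_scope.

Section Sphere.
Context {R : realType}.
Local Notation point := 'rV[R]_3.
Local Notation poly3 := (mpoly.mpoly 3 R).

Definition dotp (x y : point) : R := \sum_(i < 3) x 0 i * y 0 i.

(* The library norm on ['rV[R]_3] is the sup norm, so the Euclidean unit sphere
   is defined through the inner product. *)
Definition sphere : set point := [set x | dotp x x = 1].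

Definition sdist (x y : point) : R := acos (dotp x y).

Definition cap (c : point) (g : R) : set point :=
  [set x | sphere x /\ sdist x c <= g].

Definition spherical_coord (theta phi : R) : point :=
  \row_(i < 3) [:: sin theta * cos phi; sin theta * sin phi; cos theta]`_i.

(* Surface integral over the unit sphere: the surface measure is
   [sin theta dphi dtheta] in spherical coordinates. *)
Definition sphere_int (f : point -> R) : R :=
  \int[lebesgue_measure]_(theta in `[0, pi])
    \int[lebesgue_measure]_(phi in `[0, 2 * pi])
      (f (spherical_coord theta phi) * sin theta).

Definition peval (p : poly3) (x : point) : R :=
  mpoly.meval (fun i => x 0 i) p.

(* Functions on the sphere are represented by functions on R^3 of which only
   the values on [sphere] matter.  [mpoly.msize p] is one more than the total
   degree of [p] (and 0 for [p = 0]). *)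
Definition spherical_poly (t : nat) : set (point -> R) :=
  [set f | exists2 p : poly3, (mpoly.msize p <= t.+1)%N &
           {in sphere, forall x, f x = peval p x}].

Definition laplacian (p : poly3) : poly3 :=
  \sum_(i < 3) mpoly.mderiv i (mpoly.mderiv i p).

Definition spherical_harmonic (l : nat) : set (point -> R) :=
  [set f | exists p : poly3,
           [/\ p \is mpoly.ishomog1 l mpoly.mdeg, laplacian p = 0 &
               {in sphere, forall x, f x = peval p x}]].

(* A real L2-orthonormal spherical harmonic basis.  The order index is 0-based:
   [Y l k] is meaningful for [k < 2 * l + 1]. *)
Record sph_harm_basis (Y : nat -> nat -> point -> R) : Prop := SphHarmBasis {
  shb_harmonic : forall l k, (k < (2 * l).+1)%N -> spherical_harmonic l (Y l k);
  shb_span : forall l f, spherical_harmonic l f ->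
    exists a : 'I_(2 * l).+1 -> R,
      {in sphere, forall x, f x = \sum_k a k * Y l k x};
  shb_orthonormal : forall l k l' k',
    (k < (2 * l).+1)%N -> (k' < (2 * l').+1)%N ->
    sphere_int (fun x => Y l k x * Y l' k' x) = ((l == l') && (k == k'))%:R
}.

(* Columns are 0-based: column [j] corresponds to the unique pair [(l, k)] with
   [j = l ^ 2 + k] and [k <= 2 * l]; see [harm_mxE]. *)
Definition col_deg (j : nat) : nat := \max_(l < j.+1 | (l ^ 2 <= j)%N) l.

Definition harm_mx (Y : nat -> nat -> point -> R) (t n : nat)
    (X : 'I_n -> point) : 'M[R]_(n, (t.+1 ^ 2)%N) :=
  \matrix_(i, j) Y (col_deg j) (j - col_deg j ^ 2)%N (X i).

Lemma col_degE l k : (k < (2 * l).+1)%N -> col_deg (l ^ 2 + k) = l.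
Proof.
move=> hk; apply/eqP; rewrite eqn_leq; apply/andP; split.
  apply/bigmax_leqP => -[m hm] /= hml; rewrite leqNgt; apply/negP => hlm.
  have : (l.+1 ^ 2 <= l ^ 2 + k)%N by rewrite (leq_trans _ hml)// leq_exp2r.
  by rewrite -addn1 sqrnD muln1 -addnA leq_add2l add1n ltnNge -ltnS hk.
have hl : (l < (l ^ 2 + k).+1)%N.
  by rewrite ltnS (leq_trans _ (leq_addr _ _))//; case: l {hk} => // l;
     rewrite -mulnn leq_pmulr.
by rewrite /col_deg (bigD1 (Ordinal hl)) /= ?leq_addr// leq_maxl.
Qed.

Lemma harm_mxE Y t n (X : 'I_n -> point) i l k
    (j : 'I_(t.+1 ^ 2)%N) : (k < (2 * l).+1)%N -> j = (l ^ 2 + k)%N :> nat ->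
  harm_mx Y t X i j = Y l k (X i).
Proof. by move=> hk hj; rewrite mxE hj col_degE// addKn. Qed.

Definition mxnorm1 (m n : nat) (A : 'M[R]_(m, n)) : R :=
  \big[Num.max/0]_(j < n) \sum_(i < m) `|A i j|.

Definition point_set (n : nat) (X : 'I_n -> point) : Prop :=
  (forall i, sphere (X i)) /\ injective X.

Definition caps_rad (n : nat) (g : 'I_n -> R) : R := \big[Num.max/0]_(i < n) g i.

(* The caps being compact, this infimum is attained as soon as [2 <= n]. *)
Definition caps_sep (n : nat) (c : 'I_n -> point) (g : 'I_n -> R) : R :=
  inf [set d | exists i j x y, [/\ i != j, cap (c i) (g i) x,
                                   cap (c j) (g j) y & d = sdist x y]].

Definition in_caps (n : nat) (c : 'I_n -> point) (g : 'I_n -> R)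
    (X : 'I_n -> point) : Prop :=
  forall i, cap (c i) (g i) (X i) /\
            (forall j, j != i -> ~ cap (c j) (g j) (X i)).

Definition spherical_design (t n : nat) (X : 'I_n -> point) : Prop :=
  forall f, spherical_poly t f ->
    n%:R^-1 * \sum_(j < n) f (X j) = (4 * pi)^-1 * sphere_int f.

(* Meant for [0 <= eps < 1]. *)
Definition spherical_eps_design (t : nat) (eps : R) (n : nat)
    (X : 'I_n -> point) : Prop :=
  exists w : 'I_n -> R,
    (forall i, 4 * pi / n%:R * (1 - eps) <= w i <=
               4 * pi / n%:R * (1 - eps)^-1) /\
    (forall f, spherical_poly t f ->
       \sum_(i < n) w i * f (X i) = sphere_int f).

Definition fundamental (t n : nat) (X : 'I_n -> point) : Prop :=
  forall f, spherical_poly t f -> (forall i, f (X i) = 0) ->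
    {in sphere, forall x, f x = 0}.

End Sphere.

(* Main.v *)
Require Import Defs.
From HB Require Import structures.
From mathcomp Require Import all_boot all_order all_algebra.
From mathcomp Require Import all_classical all_reals all_analysis.
From mathcomp Require mpoly.
From mathcomp Require Import zify ring lra.
Import (canonicals, coercions) mpoly.
Import Order.TTheory GRing.Theory Num.Theory.
Import numFieldNormedType.Exports.

(** Write [Y(Z)] for [harm_mx Y t Z], [r] for the radius and [K] for the norm
    of [invmx (Y(c))].  The quantitative input is that a harmonic [Y l k] with
    [l <= t] varies by at most [(t+1) sqrt((2t+1)/4pi) d] between points at
    spherical distance [d] ([harm_col_lipschitz]).  Summing over the
    [(t+1)^2] rows, [Y(X)] and [Y(X0)] both lie within [tau r] of [Y(c)] in
    the norm [mxnorm1] ([harm_mx_perturb]), and the hypothesis on [r]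
    rearranges to [2 s < eps (1 - 4 s)] where [s = tau r K].  Hence [Y(X)] is
    still invertible ([unitmx_perturb]); as the columns span the spherical
    polynomials of degree at most [t] ([spherical_poly_span]), [X] is
    fundamental.  The weights [w] solve [w Y(X) = b], where [b] lists the
    integrals of the columns.  The design [X0] gives [b = e 1 Y(X0)] with
    [e = 4pi/(t+1)^2], so [v = w - e 1] solves [v Y(X) = e 1 (Y(X0) - Y(X))], and
    [mxnorm1_perturb] bounds its entries by [e 2s/(1-s) <= e eps].

    The Lipschitz bound is proved infinitesimally, through the rotation fields
    [L_ab = x_a d_b - x_b d_a] ([rotder]).  They commute with the Laplacian, so
    they act on the harmonics of a fixed degree, and their values on polynomials
    have mean zero on the sphere ([poly_int_rotder]).  The latter is the rotation invariance of the
    surface integral, obtained without a change of variables: by the Fischer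
    decomposition ([fischer]) every homogeneous polynomial is a sum of harmonics
    on the sphere, and a harmonic of positive degree has mean zero since it is
    orthogonal to the constant [Y 0 0].  Consequently [L_ab] acts on the
    orthonormal basis of degree [l] by an antisymmetric matrix.  Antisymmetry
    makes [sum_k (Y l k)^2] constant, with value [(2l+1)/4pi], and with the
    Casimir identity [sum_ab L_ab^2 = -2 l (l+1)] on harmonics of degree [l]
    it gives [sum_ab sum_k (L_ab (Y l k))^2 = 2 l (l+1) (2l+1)/4pi].  Along a
    great circle the derivative is half a combination of the [L_ab] with
    coefficients of square sum 2, so Cauchy-Schwarz bounds it by
    [sqrt(l (l+1) (2l+1)/4pi)], and the mean value theorem concludes. *)

Set Implicit Arguments.
Unset Strict Implicit.
Unset Printing Implicit Defensive.

Local Open Scope ring_scope.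

Section SphericalHarmonics.
Local Open Scope classical_set_scope.
Context {R : realType}.
Local Notation point := 'rV[R]_3.
Local Notation poly3 := (mpoly.mpoly 3 R).
Local Notation mu := (@lebesgue_measure R).
Local Notation homog n := (mpoly.ishomog1 n mpoly.mdeg).
Local Notation "'d_ i" := (mpoly.mderiv i)
  (at level 8, i at level 2, format "''d_' i").
Local Notation "''x_' i" := (mpoly.mpolyX R (mpoly.mnm1 i) : poly3)
  (at level 8, i at level 2, format "''x_' i").

(** * Rotation fields and the Laplacian on polynomials *)

Lemma mderiv_var (i j : 'I_3) : 'd_i 'x_j = (i == j)%:R :> poly3.
Proof.
rewrite mpoly.mderivX mpoly.mnm1E eq_sym; case: eqP => [->|_]; last by rewrite scale0r.
rewrite scale1r -(mpoly.mpolyX0 3 R); congr mpoly.mpolyX; apply/mpoly.mnmP => k.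
by rewrite mpoly.mnmBE subnn mpoly.mnm0E.
Qed.

Lemma mderiv_nat (i : 'I_3) n : 'd_i (n%:R : poly3) = 0.
Proof. by rewrite -mpoly.mpolyC_nat mpoly.mderivC. Qed.

Definition sqnorm : poly3 := \sum_(i < 3) 'x_i * 'x_i.

(** The derivative along the infinitesimal rotation of the plane [(a, b)]. *)
Definition rotder (a b : 'I_3) (p : poly3) : poly3 := 'x_a * 'd_b p - 'x_b * 'd_a p.

Definition euler (p : poly3) : poly3 := \sum_(i < 3) 'x_i * 'd_i p.

Lemma laplacianD : {morph (@laplacian R) : p q / p + q}.
Proof.
by move=> p q; rewrite -big_split; apply: eq_bigr => i _; rewrite !mpoly.mderivD.
Qed.

Lemma laplacianZ a : {morph (@laplacian R) : p / a *: p}.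
Proof.
by move=> p; rewrite scaler_sumr; apply: eq_bigr => i _; rewrite !mpoly.mderivZ.
Qed.

Lemma laplacian_is_linear : linear (@laplacian R).
Proof. by move=> a p q; rewrite laplacianD laplacianZ. Qed.

HB.instance Definition _ :=
  GRing.isLinear.Build R poly3 poly3 _ (@laplacian R) laplacian_is_linear.

Lemma rotder_is_linear a b : linear (rotder a b).
Proof.
move=> c p q; rewrite /rotder !mpoly.mderivD !mpoly.mderivZ !mulrDr -!scalerAr scalerBr.
ring.
Qed.

HB.instance Definition _ a b :=
  GRing.isLinear.Build R poly3 poly3 _ (rotder a b) (rotder_is_linear a b).

Lemma laplacianMX (i : 'I_3) (q : poly3) :
  laplacian ('x_i * q) = 'x_i * laplacian q + 'd_i q *+ 2.
Proof.
rewrite /laplacian mulr_sumr.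
rewrite (eq_bigr (fun j => 'x_i * 'd_j ('d_j q) + (j == i)%:R * 'd_j q *+ 2)).
  rewrite big_split /= [X in _ + X](bigD1 i)//= eqxx mul1r.
  rewrite [X in _ *+ 2 + X]big1 ?addr0// => j ji.
  by rewrite (negbTE ji) mul0r mul0rn.
move=> j _; rewrite !(mpoly.mderivM, mpoly.mderivD) mderiv_var mderiv_nat.
ring.
Qed.

Lemma laplacian_mderiv i (p : poly3) : laplacian ('d_i p) = 'd_i (laplacian p).
Proof.
rewrite /laplacian raddf_sum; apply: eq_bigr => j _.
by rewrite !(mpoly.mderiv_comm i).
Qed.

(** The correction terms of [laplacianMX] are the two mixed second derivatives,
    which cancel by symmetry. *)
Lemma laplacian_rotder a b p : laplacian (rotder a b p) = rotder a b (laplacian p).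
Proof.
rewrite raddfB/= !laplacianMX !laplacian_mderiv /rotder (mpoly.mderiv_comm b a).
ring.
Qed.

Lemma rotderM a b p q : rotder a b (p * q) = rotder a b p * q + p * rotder a b q.
Proof. rewrite /rotder !mpoly.mderivM; ring. Qed.

Lemma mderiv_sqnorm i : 'd_i sqnorm = 'x_i *+ 2.
Proof.
rewrite raddf_sum (bigD1 i)//= big1 ?addr0 => [|j ji]; rewrite mpoly.mderivM mderiv_var.
  by rewrite eqxx mul1r mulr1.
by rewrite eq_sym (negbTE ji) mul0r mulr0 addr0.
Qed.

(** Rotations preserve the distance to the origin. *)
Lemma rotder_sqnormX a b n : rotder a b (sqnorm ^+ n) = 0.
Proof.
elim: n => [|n ih]; first by rewrite expr0 /rotder !(mderiv_nat _ 1) !mulr0 subrr.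
rewrite exprS rotderM ih mulr0 addr0 /rotder !mderiv_sqnorm; ring.
Qed.

Lemma rotder_sqnormM a b n p : rotder a b (sqnorm ^+ n * p) = sqnorm ^+ n * rotder a b p.
Proof. by rewrite rotderM rotder_sqnormX mul0r add0r. Qed.

Lemma laplacian_sqnormM p :
  laplacian (sqnorm * p) = sqnorm * laplacian p + euler p *+ 4 + p *+ 6.
Proof.
rewrite {1}/sqnorm mulr_suml raddf_sum /=.
rewrite (eq_bigr (fun i => 'x_i * 'x_i * laplacian p + 'x_i * 'd_i p *+ 4 + p *+ 2)).
  by rewrite !big_split /= -mulr_suml -/sqnorm -/(euler p) sumr_const card_ord; ring.
move=> i _; rewrite -mulrA !laplacianMX !mpoly.mderivM mderiv_var eqxx mul1r; ring.
Qed.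

(** The sum is twice the angular part of the Laplacian: on a harmonic of degree
    [l] the right-hand side is [- 2 l (l + 1)] times the polynomial. *)
Lemma casimir p :
  \sum_a \sum_b rotder a b (rotder a b p) =
  (sqnorm * laplacian p - euler (euler p) - euler p) *+ 2.
Proof.
pose T (a b : 'I_3) : poly3 := 'x_a * 'x_a * 'd_b ('d_b p).
pose U (a b : 'I_3) : poly3 := 'x_a * 'x_b * 'd_a ('d_b p).
have TE : \sum_a \sum_b T a b = sqnorm * laplacian p.
  rewrite mulr_suml; apply: eq_bigr => a _; rewrite mulr_sumr; exact: eq_bigr.
have UE : \sum_a \sum_b U a b = euler (euler p) - euler p.
  rewrite -sumrB; apply: eq_bigr => a _.
  have -> : 'd_a (euler p) = 'd_a p + \sum_b 'x_b * 'd_a ('d_b p).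
    rewrite raddf_sum /=.
    rewrite (eq_bigr (fun b => (a == b)%:R * 'd_b p + 'x_b * 'd_a ('d_b p))); last first.
      by move=> b _; rewrite mpoly.mderivM mderiv_var.
    rewrite big_split/= (bigD1 a)//= eqxx mul1r [X in _ + X + _]big1 ?addr0// => j ja.
    by rewrite eq_sym (negbTE ja) mul0r.
  rewrite mulrDr addrC addKr mulr_sumr.
  by apply: eq_bigr => b _; rewrite mulrA.
have step a b : rotder a b (rotder a b p) =
    T a b + T b a - U a b - U b a + (a == b)%:R * ('x_a * 'd_b p) *+ 2
    - 'x_a * 'd_a p - 'x_b * 'd_b p.
  rewrite /rotder /T /U !raddfB/= !mpoly.mderivM !mderiv_var !eqxx.
  rewrite (mpoly.mderiv_comm b a) (eq_sym b a); case: eqP => [->|_] /=; ring.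
have TE' : \sum_a \sum_b T b a = sqnorm * laplacian p by rewrite exchange_big.
have UE' : \sum_a \sum_b U b a = euler (euler p) - euler p by rewrite exchange_big.
have VE : \sum_(a < 3) \sum_(b < 3) (a == b)%:R * ('x_a * 'd_b p) = euler p.
  apply: eq_bigr => a _; rewrite (bigD1 a)//= eqxx mul1r big1 ?addr0// => b ba.
  by rewrite eq_sym (negbTE ba) mul0r.
have WE : \sum_(a < 3) \sum_(b < 3) 'x_b * 'd_b p = euler p *+ 3.
  by rewrite sumr_const card_ord.
have WE' : \sum_(a < 3) \sum_(b < 3) 'x_a * 'd_a p = euler p *+ 3.
  by rewrite exchange_big.
under eq_bigr do (under eq_bigr do rewrite step).
under eq_bigr do rewrite !(sumrB, big_split) /=.
rewrite !(sumrB, big_split) /= TE TE' UE UE' VE WE WE'.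
ring.
Qed.

(** * Homogeneous polynomials and the Fischer decomposition *)

Lemma homog_mderiv d i (p : poly3) : p \is homog d.+1 -> 'd_i p \is homog d.
Proof.
move=> /mpoly.dhomogP hp; apply/mpoly.dhomogP => m; rewrite mpoly.mcoeff_msupp.
rewrite mpoly.mcoeff_mderiv => h.
have : mpoly.mdeg (mpoly.mnm_add m (mpoly.mnm1 i)) = d.+1.
  by apply: hp; rewrite mpoly.mcoeff_msupp; apply: contra_neq h => ->; rewrite mul0rn.
by rewrite mpoly.mdegD mpoly.mdeg1 addn1 => -[].
Qed.

Lemma homog0_mderiv i (p : poly3) : p \is homog 0 -> 'd_i p = 0.
Proof.
move=> /mpoly.dhomogP hp; apply/mpoly.mpolyP => m.
rewrite mpoly.mcoeff0 mpoly.mcoeff_mderiv (_ : mpoly.mcoeff _ _ = 0) ?mul0rn//.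
apply/eqP; apply: contraT; rewrite -mpoly.mcoeff_msupp => /hp h.
have : mpoly.mdeg (mpoly.mnm_add m (mpoly.mnm1 i)) = 0%N by [].
by rewrite mpoly.mdegD mpoly.mdeg1 addn1.
Qed.

Lemma homog_var (i : 'I_3) : 'x_i \is homog 1.
Proof. by rewrite mpoly.dhomogX; apply/eqP; exact: mpoly.mdeg1. Qed.

Lemma homog_varM d i p : p \is homog d -> 'x_i * p \is homog d.+1.
Proof.
by move=> hp; apply: (@mpoly.dhomogM _ _ _ 1) => //; exact: homog_var.
Qed.

Lemma homog_rotder d a b p : p \is homog d -> rotder a b p \is homog d.
Proof.
case: d => [|d] hp.
  by rewrite /rotder !homog0_mderiv// !mulr0 subrr; exact: mpoly.dhomog0.
by apply: rpredB; apply: homog_varM; exact: homog_mderiv.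
Qed.

Lemma rotder_homog0 a b p : p \is homog 0 -> rotder a b p = 0.
Proof. by move=> hp; rewrite /rotder !homog0_mderiv// !mulr0 subrr. Qed.

Lemma homog_laplacian d (p : poly3) : p \is homog d.+2 -> laplacian p \is homog d.
Proof. by move=> hp; apply: rpred_sum => i _; do 2 apply: homog_mderiv. Qed.

Lemma laplacian_low d (p : poly3) : (d < 2)%N -> p \is homog d -> laplacian p = 0.
Proof.
case: d => [|[|//]] _ hp; apply: big1 => i _.
  by rewrite (homog0_mderiv _ hp) raddf0.
by rewrite homog0_mderiv//; exact: homog_mderiv.
Qed.

Lemma homog_sqnormX n : sqnorm ^+ n \is homog (2 * n).
Proof.
apply: mpoly.dhomogMn; apply: rpred_sum => i _.
by apply: homog_varM; exact: homog_var.
Qed.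

Lemma euler_homog d p : p \is homog d -> euler p = d%:R *: p.
Proof.
move=> /mpoly.dhomogP hp; rewrite /euler {2}(mpoly.mpolyE p) scaler_sumr.
under eq_bigr => i _ do rewrite {1}(mpoly.mpolyE p) raddf_sum /= mulr_sumr.
rewrite exchange_big /=; apply: eq_big_seq => m /hp hm.
have <- : mpoly.mdeg m = d by [].
rewrite mpoly.mdegE natr_sum scaler_suml; apply: eq_bigr => i _.
rewrite mpoly.mderivZ mpoly.mderivX -!scalerAr !scalerA mulrC.
(* the truncated exponent is harmless: its coefficient is 0 when [m i = 0] *)
case mi : (m i) => [|k]; first by rewrite !mul0r !scale0r.
by rewrite -mpoly.mpolyXD mpoly.addmC mpoly.submK // mpoly.lep1mP mi.
Qed.

Definition solid_harmonic (n : nat) (p : poly3) := p \is homog n /\ laplacian p = 0.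

Lemma solid_harmonic_rotder n a b p :
  solid_harmonic n p -> solid_harmonic n (rotder a b p).
Proof.
move=> [hp lp]; split; first exact: homog_rotder.
by rewrite laplacian_rotder lp raddf0.
Qed.

Lemma solid_harmonicZ n c p : solid_harmonic n p -> solid_harmonic n (c *: p).
Proof. by move=> [hp lp]; split; [exact: rpredZ|rewrite linearZ/= lp scaler0]. Qed.

(** The coefficient is a positive number: this is what makes it possible to
    invert the Laplacian explicitly in [fischer]. *)
Lemma laplacian_sqnormXM n j h : solid_harmonic n h ->
  laplacian (sqnorm ^+ j.+1 * h) =
  (2 * j.+1 * (2 * j.+1 + 2 * n + 1))%N%:R *: (sqnorm ^+ j * h).
Proof.
move=> [hh lh]; elim: j => [|j ih]; rewrite exprS -mulrA laplacian_sqnormM.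
  rewrite expr0 !mul1r lh mulr0 add0r (euler_homog hh) -(scaler_nat 4) -(scaler_nat 6).
  by rewrite scalerA -scalerDl -natrM -natrD; congr (_%:R *: _); ring.
rewrite ih (@euler_homog (2 * j.+1 + n)%N); last first.
  by apply: mpoly.dhomogM => //; exact: homog_sqnormX.
rewrite -scalerAr mulrA -exprS -(scaler_nat 4) -(scaler_nat 6) scalerA.
rewrite -!scalerDl -natrM -!natrD.
by congr (_%:R *: _); ring.
Qed.

(** By induction on the degree: decompose the Laplacian of [p], and use
    [laplacian_sqnormXM] to build from its components a multiple [q] of the
    squared norm with the same Laplacian; then [p - q] is harmonic. *)
Lemma fischer n p : p \is homog n -> exists2 h : nat -> poly3,
  (forall j, (2 * j <= n)%N -> solid_harmonic (n - 2 * j) (h j)) &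
  p = \sum_(j < n./2.+1) sqnorm ^+ j * h j.
Proof.
elim/ltn_ind: n p => n IH p hp.
have [n2|] := ltnP n 2.
  exists (fun=> p) => [j jn|].
    have -> : j = 0%N by move: n2 jn; case: j => // j; lia.
    by rewrite muln0 subn0; split => //; exact: laplacian_low hp.
  by have -> : n./2 = 0%N by [move: n2; case: n {IH hp} => [|[]]]; rewrite big_ord1 mul1r.
case: n hp IH => [|[|n]]// hp IH _.
have [h hh dp] := IH n (leqnSn n.+1) _ (homog_laplacian hp).
pose c j : R := (2 * j.+1 * (2 * j.+1 + 2 * (n - 2 * j) + 1))%N%:R.
pose h' j := (c j)^-1 *: h j.
have c0 j : c j != 0 by rewrite pnatr_eq0 !muln_eq0 addn1.
pose q := \sum_(j < n./2.+1) sqnorm ^+ j.+1 * h' j.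
have hh' j : (2 * j <= n)%N -> solid_harmonic (n - 2 * j) (h' j).
  by move=> jn; apply: solid_harmonicZ; exact: hh.
exists (fun j => if j is j'.+1 then h' j' else p - q) => [[|j] jn|].
- rewrite muln0 subn0 {jn}; split.
    apply: rpredB => //; apply: rpred_sum => j _.
    have jn : (2 * j <= n)%N by have := ltn_ord j; lia.
    have -> : n.+2 = (2 * j.+1 + (n - 2 * j))%N by lia.
    by apply: mpoly.dhomogM; [exact: homog_sqnormX|case: (hh' j jn)].
  suff -> : laplacian (p - q) = laplacian p - laplacian q.
    apply/eqP; rewrite subr_eq0 dp raddf_sum; apply/eqP/eq_bigr => j _ /=.
    have jn : (2 * j <= n)%N by have := ltn_ord j; lia.
    rewrite (laplacian_sqnormXM _ (hh' j jn)) -/(c j) /h' -scalerAr scalerA.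
    by rewrite divff// scale1r.
  exact: raddfB.
- have -> : (n.+2 - 2 * j.+1 = n - 2 * j)%N by lia.
  by apply: hh'; lia.
- by rewrite big_ord_recl /= expr0 mul1r -/q subrK.
Qed.

(** * Evaluation of polynomials along a curve *)

Lemma pevalD p q (x : point) : peval (p + q) x = peval p x + peval q x.
Proof. exact: mpoly.mevalD. Qed.

Lemma pevalB p q (x : point) : peval (p - q) x = peval p x - peval q x.
Proof. exact: mpoly.mevalB. Qed.

Lemma pevalM p q (x : point) : peval (p * q) x = peval p x * peval q x.
Proof. exact: mpoly.mevalM. Qed.

Lemma pevalZ c p (x : point) : peval (c *: p) x = c * peval p x.
Proof. exact: mpoly.mevalZ. Qed.

Lemma pevalC c (x : point) : peval (mpoly.mpolyC 3 c) x = c.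
Proof. exact: mpoly.mevalC. Qed.

Lemma peval0 (x : point) : peval 0 x = 0.
Proof. exact: mpoly.meval0. Qed.

Lemma peval1 (x : point) : peval 1 x = 1.
Proof. exact: mpoly.meval1. Qed.

Lemma pevalX i (x : point) : peval 'x_i x = x 0 i.
Proof. exact: mpoly.mevalXU. Qed.

Lemma peval_sum (I : Type) (r : seq I) (P : pred I) (F : I -> poly3) x :
  peval (\sum_(i <- r | P i) F i) x = \sum_(i <- r | P i) peval (F i) x.
Proof. by rewrite (big_morph (peval^~ x) (fun p q => pevalD p q x) (peval0 x)). Qed.

Lemma peval_sqnormXM j p x : sphere x -> peval (sqnorm ^+ j * p) x = peval p x.
Proof.
move=> hx; elim: j => [|j ih]; first by rewrite mul1r.
rewrite exprS -mulrA pevalM ih peval_sum.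
by under eq_bigr do rewrite pevalM !pevalX; rewrite -/(dotp x x) hx mul1r.
Qed.

Lemma mpoly_ring_ind (P : poly3 -> Prop) :
  (forall c, P (mpoly.mpolyC 3 c)) -> (forall i, P 'x_i) ->
  (forall p q, P p -> P q -> P (p + q)) -> (forall p q, P p -> P q -> P (p * q)) ->
  forall p, P p.
Proof.
move=> PC PX PD PM; elim/mpoly.mpolyind => [|c m p _ _ Pp].
  by rewrite -(mpoly.mpolyC0 3 R).
apply: (PD) => //; rewrite -mpoly.mul_mpolyC; apply: (PM) => //.
have P1 : P 1 by rewrite -(mpoly.mpolyC1 3 R).
rewrite mpoly.mpolyXE_id; apply: (big_ind P P1 PM) => i _.
by elim: (m i) => [|k ih]; rewrite ?expr0// exprS; apply: (PM).
Qed.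

Lemma is_derive_peval (x : R -> point) (x' : point) (s : R) p :
  (forall i, is_derive s 1 (fun u => x u 0 i) (x' 0 i)) ->
  is_derive s 1 (fun u => peval p (x u)) (\sum_i peval ('d_i p) (x s) * x' 0 i).
Proof.
move=> dx; elim/mpoly_ring_ind: p => [c|i|p q dp dq|p q dp dq].
- rewrite (_ : (fun u => _) = cst c); last by apply/funext => u; rewrite pevalC.
  by apply: is_derive_eq; rewrite big1// => i _; rewrite mpoly.mderivC peval0 mul0r.
- rewrite (_ : (fun u => _) = fun u => x u 0 i); last first.
    by apply/funext => u; rewrite pevalX.
  apply: is_derive_eq; rewrite (bigD1 i)//= big1 ?addr0 => [|j ji]; rewrite mderiv_var.
    by rewrite eqxx peval1 mul1r.
  by rewrite (negbTE ji) peval0 mul0r.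
- rewrite (_ : (fun u => _) =
    (fun u => peval p (x u)) \+ (fun u => peval q (x u))); last first.
    by apply/funext => u; rewrite pevalD.
  apply: is_derive_eq; rewrite -big_split; apply: eq_bigr => i _ /=.
  by rewrite mpoly.mderivD pevalD mulrDl.
- rewrite (_ : (fun u => _) =
    (fun u => peval p (x u)) * (fun u => peval q (x u))); last first.
    by apply/funext => u; rewrite pevalM.
  apply: is_derive_eq; rewrite !scaler_sumr -big_split; apply: eq_bigr => i _ /=.
  rewrite mpoly.mderivM pevalD !pevalM /GRing.scale /=; ring.
Qed.

(** * The surface integral of polynomials *)

Lemma spherical_coord_sphere (theta phi : R) : sphere (spherical_coord theta phi).
Proof.
rewrite /sphere /= /dotp !big_ord_recl big_ord0 !mxE /= addr0.
have c1 := cos2Dsin2 theta; have c2 := cos2Dsin2 phi.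
transitivity (sin theta ^+ 2 * (cos phi ^+ 2 + sin phi ^+ 2) + cos theta ^+ 2).
  by ring.
by rewrite c2 mulr1 addrC.
Qed.

Lemma continuous_mulr (f g : R -> R) :
  continuous f -> continuous g -> continuous (fun u => f u * g u).
Proof. by move=> cf cg u; apply: continuousM; [exact: cf|exact: cg]. Qed.

Lemma continuous_addr (f g : R -> R) :
  continuous f -> continuous g -> continuous (fun u => f u + g u).
Proof. by move=> cf cg u; apply: continuousD; [exact: cf|exact: cg]. Qed.

Lemma continuous_exprn (f : R -> R) n :
  continuous f -> continuous (fun u => f u ^+ n).
Proof.
move=> cf u.
exact: (@continuous_comp R R R f (fun x => x ^+ n) u (cf u) (@exprn_continuous R n _)).
Qed.

Lemma continuous_integrable (f : R -> R) (a b : R) :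
  continuous f -> mu.-integrable `[a, b] (EFin \o f).
Proof.
move=> cf; apply: continuous_compact_integrable; first exact: segment_compact.
exact: continuous_subspaceT.
Qed.

Lemma continuous_Rintegral_lin (f g : R -> R) (a b c : R) :
  continuous f -> continuous g ->
  \int[mu]_(x in `[a, b]) (c * f x + g x) =
  c * \int[mu]_(x in `[a, b]) f x + \int[mu]_(x in `[a, b]) g x.
Proof.
move=> cf cg; rewrite RintegralD//; last exact: continuous_integrable.
  by rewrite RintegralZl//; exact: continuous_integrable.
apply: (@continuous_integrable (fun x => c * f x)).
by apply: continuous_mulr => // ?; exact: cst_continuous.
Qed.

Lemma continuous_peval (x : R -> point) p :
  (forall i, continuous (fun u => x u 0 i)) -> continuous (fun u => peval p (x u)).
Proof.
move=> cx; move: p; apply: mpoly_ring_ind => [c|i|p q cp cq|p q cp cq].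
- rewrite (_ : (fun u => _) = cst c); first exact: cst_continuous.
  by apply/funext => u; rewrite pevalC.
- rewrite (_ : (fun u => _) = fun u => x u 0 i)//.
  by apply/funext => u; rewrite pevalX.
- rewrite (_ : (fun u => _) = (fun u => peval p (x u)) \+ (fun u => peval q (x u))).
    by move=> u; apply: continuousD; [exact: cp|exact: cq].
  by apply/funext => u; rewrite pevalD.
- rewrite (_ : (fun u => _) = (fun u => peval p (x u)) \* (fun u => peval q (x u))).
    by move=> u; apply: continuousM; [exact: cp|exact: cq].
  by apply/funext => u; rewrite pevalM.
Qed.

Lemma continuous_longitude p (theta : R) :
  continuous (fun phi : R => peval p (spherical_coord theta phi) * sin theta).
Proof.
apply: continuous_mulr; last by move=> ?; exact: cst_continuous.
apply: continuous_peval => i.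
rewrite (_ : (fun u => _) =
  fun u => [:: sin theta * cos u; sin theta * sin u; cos theta]`_i).
  case: i => -[|[|[|//]]] _ /=.
  - by apply: continuous_mulr; [move=> ?; exact: cst_continuous|exact: continuous_cos].
  - by apply: continuous_mulr; [move=> ?; exact: cst_continuous|exact: continuous_sin].
  - by move=> ?; exact: cst_continuous.
by apply/funext => u; rewrite mxE.
Qed.

Definition longitude_int (p : poly3) (theta : R) : R :=
  \int[mu]_(phi in `[0, 2 * pi]) (peval p (spherical_coord theta phi) * sin theta).

Lemma longitude_int_linear c p q theta :
  longitude_int (c *: p + q) theta = c * longitude_int p theta + longitude_int q theta.
Proof.
rewrite -continuous_Rintegral_lin; try exact: continuous_longitude.
apply: eq_Rintegral => phi _.
by rewrite pevalD pevalZ; ring.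
Qed.

(** On a monomial the integrand separates in the two angles; this is why the
    inner integral is continuous in the outer angle. *)
Lemma longitude_intX m theta : longitude_int (mpoly.mpolyX R m) theta =
  sin theta ^+ m ord0 * sin theta ^+ m (inord 1) * cos theta ^+ m (inord 2) * sin theta *
  \int[mu]_(phi in `[0, 2 * pi]) (cos phi ^+ m ord0 * sin phi ^+ m (inord 1)).
Proof.
rewrite -RintegralZl//; last first.
  apply: (@continuous_integrable (fun phi => cos phi ^+ m ord0 * sin phi ^+ m (inord 1))).
  apply: continuous_mulr; apply: continuous_exprn; first exact: continuous_cos.
  exact: continuous_sin.
apply: eq_Rintegral => phi _; rewrite /peval mpoly.mevalX !big_ord_recl big_ord0 !mxE /=.
rewrite (_ : lift ord0 ord0 = inord 1 :> 'I_3); last by apply/val_inj; rewrite /= inordK.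
rewrite (_ : lift ord0 (lift ord0 ord0) = inord 2 :> 'I_3); last first.
  by apply/val_inj; rewrite /= inordK.
rewrite !exprMn; ring.
Qed.

Lemma continuous_longitude_int p : continuous (longitude_int p).
Proof.
elim/mpoly.mpolyind: p => [|c m p _ _ cp].
  rewrite (_ : longitude_int _ = cst 0); first exact: cst_continuous.
  apply/funext => theta; rewrite /longitude_int.
  under eq_Rintegral do rewrite peval0 mul0r.
  by rewrite Rintegral_cst// mul0r.
rewrite (_ : longitude_int _ = fun theta =>
  c * longitude_int (mpoly.mpolyX R m) theta + longitude_int p theta).
  apply: continuous_addr => //.
  apply: continuous_mulr; first by move=> ?; exact: cst_continuous.
  rewrite (funext (longitude_intX m)).
  apply: continuous_mulr; last by move=> ?; exact: cst_continuous.
  apply: continuous_mulr; last exact: continuous_sin.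
  apply: continuous_mulr; last exact/continuous_exprn/continuous_cos.
  by apply: continuous_mulr; exact/continuous_exprn/continuous_sin.
by apply/funext => theta; rewrite longitude_int_linear.
Qed.

Definition poly_int (p : poly3) : R := sphere_int (peval p).

Lemma poly_int_is_linear : linear_for *%R poly_int.
Proof.
move=> c p q; rewrite /poly_int /sphere_int.
rewrite -continuous_Rintegral_lin; try exact: continuous_longitude_int.
by apply: eq_Rintegral => theta _; rewrite -longitude_int_linear.
Qed.

HB.instance Definition _ :=
  GRing.isLinear.Build R poly3 R _ poly_int poly_int_is_linear.

Lemma eq_sphere_int (f g : point -> R) :
  {in sphere, f =1 g} -> sphere_int f = sphere_int g.
Proof.
move=> fg; apply: eq_Rintegral => theta _; apply: eq_Rintegral => phi _.
by rewrite fg// inE; exact: spherical_coord_sphere.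
Qed.

Lemma eq_poly_int p q : {in sphere, peval p =1 peval q} -> poly_int p = poly_int q.
Proof. exact: eq_sphere_int. Qed.

Lemma poly_int1 : poly_int 1 = 4 * pi.
Proof.
rewrite /poly_int /sphere_int.
have pi0 : 0 < pi :> R := pi_gt0 R.
under eq_Rintegral => theta _.
  under eq_Rintegral => phi _ do rewrite peval1 mul1r.
  rewrite Rintegral_cst//= lebesgue_measure_itv/= lte_fin mulr_gt0//= subr0 mulrC.
  over.
rewrite RintegralZl//; last exact/continuous_integrable/continuous_sin.
rewrite /Rintegral (@continuous_FTC2 _ _ (fun x => - cos x))//=.
- by rewrite cospi cos0; ring.
- exact/continuous_subspaceT/continuous_sin.
- split.
  + by move=> x _; apply: derivableN.
  + by apply: cvgN; apply: cvg_at_right_filter; exact: continuous_cos.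
  + by apply: cvgN; apply: cvg_at_left_filter; exact: continuous_cos.
- by move=> x _; rewrite derive1E deriveN// derive_val opprK.
Qed.

(** * Great circles *)

Lemma dotpC (x y : point) : dotp x y = dotp y x.
Proof. by apply: eq_bigr => i _; rewrite mulrC. Qed.

Lemma dotpDr (x y z : point) : dotp x (y + z) = dotp x y + dotp x z.
Proof. by rewrite -big_split; apply: eq_bigr => i _; rewrite mxE mulrDr. Qed.

Lemma dotpZr c (x y : point) : dotp x (c *: y) = c * dotp x y.
Proof. by rewrite mulr_sumr; apply: eq_bigr => i _; rewrite mxE mulrCA. Qed.

Lemma dotpDl (x y z : point) : dotp (x + y) z = dotp x z + dotp y z.
Proof. by rewrite dotpC dotpDr !(dotpC z). Qed.

Lemma dotpZl c (x y : point) : dotp (c *: x) y = c * dotp x y.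
Proof. by rewrite dotpC dotpZr dotpC. Qed.

Lemma dotp_ge0 (x : point) : 0 <= dotp x x.
Proof. by apply: sumr_ge0 => i _; rewrite -expr2 sqr_ge0. Qed.

Lemma dotp_eq0 (x : point) : dotp x x = 0 -> x = 0.
Proof.
move=> /eqP; rewrite psumr_eq0 => [/allP x0|i _]; last by rewrite -expr2 sqr_ge0.
apply/rowP => i; rewrite mxE; have := x0 i; rewrite mem_index_enum => /(_ isT) /=.
by rewrite -expr2 sqrf_eq0 => /eqP.
Qed.

Lemma dotp_sphere_itv (x y : point) : sphere x -> sphere y -> -1 <= dotp x y <= 1.
Proof.
rewrite /sphere /= => hx hy.
have := dotp_ge0 (x + y); have := dotp_ge0 (x + (-1) *: y).
rewrite !(dotpDr, dotpDl, dotpZr, dotpZl) (dotpC y x) hx hy => h1 h2.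
by apply/andP; split; lra.
Qed.

Definition great_arc (x v : point) (s : R) : point := cos s *: x + sin s *: v.

Definition tangent (x v : point) := [/\ sphere x, sphere v & dotp x v = 0].

Lemma great_arc_dotp x v s : tangent x v ->
  dotp (great_arc x v s) x = cos s /\ dotp (great_arc x v s) v = sin s.
Proof.
move=> [hx hv xv]; rewrite /great_arc !(dotpDl, dotpZl) (dotpC v) hx hv xv.
by rewrite !(mulr0, mulr1, addr0, add0r).
Qed.

Lemma great_arc_sphere x v s : tangent x v -> sphere (great_arc x v s).
Proof.
move=> /(great_arc_dotp s) [h1 h2].
rewrite /sphere /= {2}/great_arc dotpDr !dotpZr h1 h2.
by rewrite -!expr2 cos2Dsin2.
Qed.

Lemma sphere_orthogonal (x : point) : sphere x -> exists v, tangent x v.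
Proof.
move=> hx.
have e k : sphere (\row_i (i == k)%:R : point).
  rewrite /sphere /= /dotp (bigD1 k)//= mxE eqxx mul1r big1 ?addr0// => i ik.
  by rewrite mxE (negbTE ik) mul0r.
pose w : point := \row_i [:: - x 0 (inord 1); x 0 ord0; 0]`_i.
have i1 : lift ord0 ord0 = inord 1 :> 'I_3 by apply/val_inj; rewrite /= inordK.
have xw : dotp x w = 0.
  by rewrite /dotp !big_ord_recl big_ord0 !mxE /= i1; ring.
have [w0|w0] := eqVneq (dotp w w) 0.
  exists (\row_i (i == ord0)%:R); split => //.
  have /rowP/(_ (inord 1)) := dotp_eq0 w0; rewrite !mxE inordK//= => x0.
  rewrite /dotp (bigD1 ord0)//= mxE eqxx mulr1 x0 add0r big1 // => i i0.
  by rewrite mxE (negbTE i0) mulr0.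
exists ((Num.sqrt (dotp w w))^-1 *: w); split => //.
  rewrite /sphere /= dotpZr dotpZl -[X in _ * (_ * X)]sqr_sqrtr ?dotp_ge0//.
  have s0 : Num.sqrt (dotp w w) != 0.
    by rewrite sqrtr_eq0 -ltNge lt_neqAle eq_sym w0 dotp_ge0.
  by field.
by rewrite dotpZr xw mulr0.
Qed.

(** [v] is the normalized component of [y] orthogonal to [x]; when [y] is [x] or
    [- x] this component is zero and any unit tangent vector will do. *)
Lemma great_arc_connected (x y : point) : sphere x -> sphere y ->
  exists2 v, tangent x v & y = great_arc x v (sdist x y).
Proof.
move=> hx hy; rewrite /sdist; have /andP[c1 c2] := dotp_sphere_itv hx hy.
set c := dotp x y in c1 c2 *.
have cI : -1 <= c <= 1 by rewrite c1 c2.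
rewrite /great_arc acosK ?in_itv// sin_acos//.
pose u := y + (- c) *: x.
have xu : dotp x u = 0 by rewrite dotpDr dotpZr hx -/c; ring.
have uu : dotp u u = 1 - c ^+ 2.
  rewrite {2}/u dotpDr dotpZr (dotpC u x) xu /u dotpDl dotpZl hy -/c; ring.
have yE : y = c *: x + u by rewrite /u scaleNr addrCA subrr addr0.
have [s0|s0] := eqVneq (dotp u u) 0.
  have [v tv] := sphere_orthogonal hx; exists v => //.
  by rewrite -uu s0 sqrtr0 scale0r addr0 {1}yE (dotp_eq0 s0) addr0.
have s1 : Num.sqrt (dotp u u) != 0.
  by rewrite sqrtr_eq0 -ltNge lt_neqAle eq_sym s0 dotp_ge0.
rewrite -uu; exists ((Num.sqrt (dotp u u))^-1 *: u); last first.
  by rewrite scalerA divff// scale1r.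
split => //; last by rewrite dotpZr xu mulr0.
rewrite /sphere /= dotpZr dotpZl -[X in _ * (_ * X)]sqr_sqrtr ?dotp_ge0//.
by field.
Qed.

(** The Pluecker coordinates of the plane spanned by [x] and [v]. *)
Definition plucker (x v : point) (a b : 'I_3) : R := x 0 a * v 0 b - x 0 b * v 0 a.

Lemma plucker_sqr x v : tangent x v -> \sum_a \sum_b plucker x v a b ^+ 2 = 2.
Proof.
move=> [hx hv xv].
have -> : \sum_a \sum_b plucker x v a b ^+ 2 =
   (dotp x x * dotp v v - dotp x v ^+ 2) *+ 2.
  rewrite /plucker /dotp !big_ord_recl !big_ord0; ring.
by rewrite hx hv xv; ring.
Qed.

(** Moving along a great circle is rotating in its plane, so its velocity is the
    combination of rotation fields given by the Pluecker coordinates; the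
    factor [2^-1] accounts for counting each pair of indices twice. *)
Lemma is_derive_great_arc p x v (s : R) : tangent x v ->
  is_derive s 1 (fun u => peval p (great_arc x v u))
    (2^-1 * \sum_a \sum_b plucker x v a b * peval (rotder a b p) (great_arc x v s)).
Proof.
move=> txv.
pose x' : point := (- sin s) *: x + cos s *: v.
have dx i : is_derive s 1 (fun u => great_arc x v u 0 i) (x' 0 i).
  have dc := @is_deriveZ R R R cos (x 0 i) s 1 _ (is_derive_cos s).
  have ds := @is_deriveZ R R R sin (v 0 i) s 1 _ (is_derive_sin s).
  have := is_deriveD dc ds.
  rewrite (_ : x 0 i *: - sin s + v 0 i *: cos s = x' 0 i); last first.
    by rewrite !mxE; congr (_ + _); exact: mulrC.
  rewrite (_ : _ + _ = (fun u => great_arc x v u 0 i))//.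
  by apply/funext => u; rewrite !mxE; congr (_ + _); exact: mulrC.
apply: is_derive_eq; first exact: (is_derive_peval p dx).
have [h1 h2] := great_arc_dotp s txv.
(* the inner products of [great_arc x v s] with [x] and [v] are [cos s], [sin s] *)
have x'E b : x' 0 b = \sum_a great_arc x v s 0 a * plucker x v a b.
  rewrite (eq_bigr (fun a => great_arc x v s 0 a * x 0 a * v 0 b -
      great_arc x v s 0 a * v 0 a * x 0 b)).
    by rewrite sumrB -!mulr_suml -/(dotp _ x) -/(dotp _ v) h1 h2 !mxE; ring.
  by move=> a _; rewrite /plucker; ring.
have rE a b : peval (rotder a b p) (great_arc x v s) =
    great_arc x v s 0 a * peval ('d_b p) (great_arc x v s) -
    great_arc x v s 0 b * peval ('d_a p) (great_arc x v s).
  by rewrite pevalB !pevalM !pevalX.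
pose G a b := plucker x v a b * great_arc x v s 0 a * peval ('d_b p) (great_arc x v s).
transitivity (\sum_b \sum_a G a b).
  apply: eq_bigr => b _; rewrite x'E mulr_sumr.
  by apply: eq_bigr => a _; rewrite /G; ring.
rewrite (_ : \sum_a \sum_b _ * _ = \sum_a \sum_b G a b + \sum_b \sum_a G a b); last first.
  rewrite -big_split; apply: eq_bigr => a _; rewrite -big_split; apply: eq_bigr => b _ /=.
  rewrite rE /G /plucker; ring.
by rewrite [X in _ * (X + _)]exchange_big /=; field.
Qed.

(** Lagrange's identity: the difference of the two sides is half of a sum of
    squares. *)
Lemma sum_cauchy_schwarz (I : finType) (u v : I -> R) :
  (\sum_i u i * v i) ^+ 2 <= (\sum_i u i ^+ 2) * (\sum_i v i ^+ 2).
Proof.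
have : 0 <= \sum_i \sum_j (u i * v j - u j * v i) ^+ 2.
  by apply: sumr_ge0 => i _; apply: sumr_ge0 => j _; exact: sqr_ge0.
have -> : \sum_i \sum_j (u i * v j - u j * v i) ^+ 2 =
    ((\sum_i u i ^+ 2) * (\sum_i v i ^+ 2) - (\sum_i u i * v i) ^+ 2) *+ 2.
  have S (f g : I -> R) : (\sum_i f i) * (\sum_i g i) = \sum_i \sum_j f i * g j.
    by rewrite mulr_suml; apply: eq_bigr => i _; rewrite mulr_sumr.
  transitivity (\sum_i \sum_j (u i ^+ 2 * v j ^+ 2 + v i ^+ 2 * u j ^+ 2 -
      (u i * v i) * (u j * v j) - (u i * v i) * (u j * v j))).
    by apply: eq_bigr => i _; apply: eq_bigr => j _; ring.
  under eq_bigr do rewrite !(sumrB, big_split) /=.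
  rewrite !(sumrB, big_split) /= -!S; ring.
by rewrite pmulrn_lge0// subr_ge0.
Qed.

(** * Orthonormal frames of harmonics *)

Lemma sum_quadform (A I : finType) (F : A -> I -> I -> R) (c : I -> I -> R) :
  \sum_i \sum_j (\sum_a F a i j) * c i j = \sum_a \sum_i \sum_j F a i j * c i j.
Proof.
rewrite [RHS]exchange_big; apply: eq_bigr => i _.
by rewrite [RHS]exchange_big; apply: eq_bigr => j _; rewrite mulr_suml.
Qed.

Definition harmonics_mean_zero :=
  forall n (h : poly3), solid_harmonic n.+1 h -> poly_int h = 0.

(** The infinitesimal form of the rotation invariance of the surface integral.
    On the sphere the field maps each Fischer component to a harmonic of the
    same degree, and kills the component of degree zero. *)
Lemma poly_int_rotder n a b (q : poly3) : harmonics_mean_zero ->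
  q \is homog n -> poly_int (rotder a b q) = 0.
Proof.
move=> mean0 /fischer[h hh ->].
rewrite !raddf_sum /= big1// => j _.
rewrite rotder_sqnormM (@eq_poly_int _ (rotder a b (h j))); last first.
  by move=> x /set_mem xS; exact: peval_sqnormXM.
have jn : (2 * j <= n)%N by have := ltn_ord j; lia.
have := hh j jn; case: (n - 2 * j)%N => [[h0 _]|d hd].
  by rewrite rotder_homog0// raddf0.
exact/(mean0 d)/solid_harmonic_rotder.
Qed.

Section Frame.
Variables (l : nat) (I : finType) (P : I -> poly3).
Hypothesis mean0 : harmonics_mean_zero.
Hypothesis harmP : forall k, solid_harmonic l (P k).
Hypothesis orthoP : forall i j, poly_int (P i * P j) = (i == j)%:R.
Hypothesis spanP : forall h, solid_harmonic l h ->
  exists a : I -> R, {in sphere, forall x, peval h x = \sum_k a k * peval (P k) x}.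

Lemma frame_expand (h : poly3) x : solid_harmonic l h -> sphere x ->
  peval h x = \sum_k poly_int (h * P k) * peval (P k) x.
Proof.
move=> /spanP[a ha] hx; rewrite ha ?inE//; apply: eq_bigr => k _; congr (_ * _).
rewrite (@eq_poly_int _ (\sum_j a j *: (P j * P k))).
  rewrite raddf_sum (bigD1 k)//= linearZ/= orthoP eqxx mulr1 big1 ?addr0// => j jk.
  by rewrite linearZ/= orthoP (negbTE jk) mulr0.
move=> y yS; rewrite pevalM ha// peval_sum mulr_suml.
by apply: eq_bigr => j _; rewrite /= pevalZ pevalM mulrA.
Qed.

Lemma frame_parseval (g h : poly3) : solid_harmonic l g -> solid_harmonic l h ->
  poly_int (g * h) = \sum_k poly_int (g * P k) * poly_int (h * P k).
Proof.
move=> hg hh.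
rewrite (@eq_poly_int _ (\sum_k poly_int (g * P k) *: (h * P k))).
  by rewrite raddf_sum; apply: eq_bigr => k _ /=; rewrite linearZ.
move=> y /set_mem yS; rewrite pevalM (frame_expand hg yS).
rewrite peval_sum mulr_suml.
by apply: eq_bigr => k _; rewrite pevalZ pevalM mulrAC mulrA.
Qed.

(** Integration by parts: the field is a derivation with mean zero values. *)
Lemma poly_int_rotder_anti a b (g h : poly3) :
  solid_harmonic l g -> solid_harmonic l h ->
  poly_int (rotder a b g * h) = - poly_int (g * rotder a b h).
Proof.
move=> [hg _] [hh _]; apply/eqP; rewrite -addr_eq0 -raddfD/= -rotderM.
by apply/eqP/(@poly_int_rotder (l + l)) => //; exact: mpoly.dhomogM.
Qed.

Definition frame_energy : poly3 := \sum_k P k * P k.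

Lemma peval_frame_energy x : peval frame_energy x = \sum_k peval (P k) x ^+ 2.
Proof. by rewrite peval_sum; apply: eq_bigr => k _; rewrite /= pevalM. Qed.

(** The field acts on the frame by an antisymmetric matrix [B], and a quadratic
    form with antisymmetric matrix vanishes. *)
Lemma peval_rotder_energy a b x : sphere x -> peval (rotder a b frame_energy) x = 0.
Proof.
move=> hx.
pose B i j := poly_int (rotder a b (P i) * P j).
have anti i j : B i j = - B j i.
  by rewrite /B (poly_int_rotder_anti a b (harmP i) (harmP j)) (mulrC (P i)).
pose S := \sum_i \sum_j B i j * peval (P j) x * peval (P i) x.
have -> : peval (rotder a b frame_energy) x = S + S.
  rewrite -big_split /frame_energy raddf_sum /= peval_sum; apply: eq_bigr => i _.
  rewrite rotderM pevalD !pevalM /=.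
  rewrite (frame_expand (solid_harmonic_rotder a b (harmP i)) hx) mulr_sumr mulr_suml.
  by congr (_ + _); apply: eq_bigr => j _ //; rewrite mulrC.
have SN : S = - S.
  rewrite {1}/S exchange_big -sumrN; apply: eq_bigr => i _.
  by rewrite -sumrN; apply: eq_bigr => j _; rewrite anti !mulNr mulrAC.
by rewrite {1}SN addNr.
Qed.

(** If the field [L_ab] has matrix [B_ab] in the frame, the left-hand side is
    the quadratic form of [sum_ab B_ab^T B_ab].  By integration by parts this
    matrix represents [- sum_ab L_ab^2], a scalar by [casimir]. *)
Lemma frame_rotder_energy x : sphere x ->
  \sum_a \sum_b \sum_k peval (rotder a b (P k)) x ^+ 2 =
  (2 * (l * l.+1))%N%:R * peval frame_energy x.
Proof.
move=> hx.
pose B a b i j := poly_int (rotder a b (P i) * P j).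
have anti a b i j : B a b i j = - B a b j i.
  by rewrite /B (poly_int_rotder_anti a b (harmP i) (harmP j)) (mulrC (P i)).
have BB a b i j : \sum_k B a b k i * B a b k j =
    - poly_int (rotder a b (rotder a b (P i)) * P j).
  rewrite poly_int_rotder_anti//; last exact: solid_harmonic_rotder.
  rewrite opprK frame_parseval; try exact: solid_harmonic_rotder.
  by apply: eq_bigr => k _; rewrite (anti _ _ k) (anti _ _ k j) mulrNN.
have casimirP i : \sum_a \sum_b rotder a b (rotder a b (P i)) =
    - (2 * (l * l.+1))%N%:R *: P i.
  have [hP lP] := harmP i.
  rewrite casimir lP mulr0 sub0r (euler_homog hP).
  rewrite (euler_homog (solid_harmonicZ l%:R (harmP i)).1).
  rewrite scalerA -opprD -scalerDl -scaleNr scalerMnl; congr (_ *: _).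
  by rewrite !natrM -(natr1 l); ring.
have sumBB i j : \sum_a \sum_b \sum_k B a b k i * B a b k j =
    (2 * (l * l.+1))%N%:R * (i == j)%:R.
  under eq_bigr do (under eq_bigr do rewrite BB; rewrite sumrN -raddf_sum -mulr_suml).
  rewrite sumrN -raddf_sum -mulr_suml casimirP scaleNr mulNr raddfN opprK.
  by rewrite -scalerAl /= linearZ/= orthoP.
transitivity (\sum_i \sum_j (\sum_a \sum_b \sum_k B a b k i * B a b k j) *
    (peval (P i) x * peval (P j) x)).
  rewrite sum_quadform; apply: eq_bigr => a _.
  rewrite sum_quadform; apply: eq_bigr => b _.
  rewrite sum_quadform; apply: eq_bigr => k _.
  have -> : peval (rotder a b (P k)) x = \sum_i B a b k i * peval (P i) x.
    exact: frame_expand (solid_harmonic_rotder a b (harmP k)) hx.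
  rewrite expr2 mulr_suml.
  apply: eq_bigr => i _; rewrite mulr_sumr; apply: eq_bigr => j _.
  exact: mulrACA.
rewrite peval_frame_energy mulr_sumr; apply: eq_bigr => i _.
transitivity (\sum_j (2 * (l * l.+1))%N%:R * (i == j)%:R *
    (peval (P i) x * peval (P j) x)).
  by apply: eq_bigr => j _; rewrite sumBB.
rewrite (bigD1 i)//= eqxx mulr1 -expr2 big1 ?addr0// => j ji.
by rewrite eq_sym (negbTE ji) mulr0 mul0r.
Qed.

Lemma frame_energy_const x y : sphere x -> sphere y ->
  peval frame_energy x = peval frame_energy y.
Proof.
move=> hx hy; have [v txv ->] := great_arc_connected hx hy.
rewrite -[in LHS](_ : great_arc x v 0 = x); last first.
  by rewrite /great_arc cos0 sin0 scale1r scale0r addr0.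
apply: (@is_derive_0_is_cst _ (fun s => peval frame_energy (great_arc x v s))) => s.
have := is_derive_great_arc frame_energy s txv.
rewrite big1 ?mulr0// => a _; rewrite big1// => b _.
by rewrite peval_rotder_energy ?mulr0//; exact: great_arc_sphere.
Qed.

(** The constant is found by integrating over the sphere, each frame element
    contributing 1.  This is the addition theorem on the diagonal. *)
Lemma frame_energyE x : sphere x -> peval frame_energy x = #|I|%:R / (4 * pi).
Proof.
move=> hx.
have : poly_int frame_energy = peval frame_energy x * (4 * pi).
  rewrite -poly_int1 (_ : _ * _ = poly_int (peval frame_energy x *: 1)); last first.
    by rewrite linearZ.
  apply: eq_poly_int => y /set_mem hy.
  by rewrite pevalZ peval1 mulr1; exact: frame_energy_const.
rewrite raddf_sum /= (eq_bigr (fun=> 1)); last by move=> i _; rewrite orthoP eqxx.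
rewrite sumr_const => ->; rewrite mulfK// mulf_neq0 ?pnatr_eq0// gt_eqF//; exact: pi_gt0.
Qed.

(** The derivative of one frame element along a great circle is bounded by
    Cauchy-Schwarz, first over the rotation planes and then by adding the
    squares of the other frame elements, whose total [frame_rotder_energy]
    evaluates. *)
Lemma frame_lipschitz k x y : sphere x -> sphere y ->
  `|peval (P k) x - peval (P k) y| <=
  Num.sqrt ((l * l.+1)%N%:R * (#|I|%:R / (4 * pi))) * sdist x y.
Proof.
move=> hx hy; have [v txv yE] := great_arc_connected hx hy.
have d0 : 0 <= sdist x y by exact/acos_ge0/dotp_sphere_itv.
pose df s := 2^-1 * \sum_a \sum_b
  plucker x v a b * peval (rotder a b (P k)) (great_arc x v s).
have dfP (s : R) : is_derive s 1 (fun u => peval (P k) (great_arc x v u)) (df s).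
  exact: is_derive_great_arc.
have cf : {within `[0, sdist x y], continuous (fun u => peval (P k) (great_arc x v u))}.
  by apply: derivable_within_continuous => s _; have [] := dfP s.
have [s _] := MVT_segment d0 (fun s _ => dfP s) cf.
rewrite -yE subr0 (_ : great_arc x v 0 = x); last first.
  by rewrite /great_arc cos0 sin0 scale1r scale0r addr0.
rewrite distrC => ->; rewrite normrM (ger0_norm d0) ler_wpM2r//.
rewrite -sqrtr_sqr ler_sqrt; last first.
  by rewrite mulr_ge0// divr_ge0// mulr_ge0// pi_ge0.
have hs : sphere (great_arc x v s) by exact: great_arc_sphere.
rewrite -(frame_energyE hs) /df pair_bigA /= exprMn.
apply: le_trans (_ : 2^-1 ^+ 2 *
  (2 * ((2 * (l * l.+1))%N%:R * peval frame_energy (great_arc x v s))) <= _); last first.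
  by rewrite natrM -subr_ge0 le_eqVlt; apply/orP; left; apply/eqP; field.
rewrite ler_wpM2l ?sqr_ge0// (le_trans (sum_cauchy_schwarz _ _))//.
rewrite -(pair_bigA _ (fun a b => plucker x v a b ^+ 2)) /= plucker_sqr// ler_wpM2l//.
rewrite -frame_rotder_energy// pair_bigA /=; apply: ler_sum => -[a b] _ /=.
by rewrite (bigD1 k)//= lerDl sumr_ge0// => j _; exact: sqr_ge0.
Qed.

End Frame.

(** * Perturbation of matrices in the maximum column sum norm *)

Lemma mxnorm1_ge0 m n (A : 'M[R]_(m, n)) : 0 <= mxnorm1 A.
Proof. exact: bigmax_ge_id. Qed.

Lemma col_le_mxnorm1 m n (A : 'M[R]_(m, n)) j : \sum_i `|A i j| <= mxnorm1 A.
Proof. exact: (le_bigmax _ (fun j => \sum_i `|A i j|)). Qed.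

Lemma mxnorm1_le m n (A : 'M[R]_(m, n)) e :
  0 <= e -> (forall j, \sum_i `|A i j| <= e) -> mxnorm1 A <= e.
Proof. by move=> e0 Ae; apply: bigmax_le. Qed.

Lemma mxnorm1D m n (A B : 'M[R]_(m, n)) : mxnorm1 (A + B) <= mxnorm1 A + mxnorm1 B.
Proof.
apply: mxnorm1_le => [|j]; first by rewrite addr_ge0 ?mxnorm1_ge0.
apply: le_trans (lerD (col_le_mxnorm1 A j) (col_le_mxnorm1 B j)).
by rewrite -big_split ler_sum// => i _; rewrite mxE ler_normD.
Qed.

Lemma mxnorm1N m n (A : 'M[R]_(m, n)) : mxnorm1 (- A) = mxnorm1 A.
Proof.
by apply: eq_bigr => j _; apply: eq_bigr => i _; rewrite mxE normrN.
Qed.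

Lemma mxnorm1M m n p (A : 'M[R]_(m, n)) (B : 'M[R]_(n, p)) :
  mxnorm1 (A *m B) <= mxnorm1 A * mxnorm1 B.
Proof.
apply: mxnorm1_le => [|j]; first by rewrite mulr_ge0 ?mxnorm1_ge0.
apply: le_trans (ler_wpM2l (mxnorm1_ge0 A) (col_le_mxnorm1 B j)).
rewrite mulr_sumr; apply: (@le_trans _ _ (\sum_i \sum_k `|A i k| * `|B k j|)).
  apply: ler_sum => i _; rewrite mxE (le_trans (ler_norm_sum _ _ _))//.
  by apply: ler_sum => k _; rewrite normrM.
rewrite exchange_big; apply: ler_sum => k _ /=.
by rewrite -mulr_suml ler_wpM2r// col_le_mxnorm1.
Qed.

Lemma row_le_mxnorm1 n (v : 'rV[R]_n) j : `|v 0 j| <= mxnorm1 v.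
Proof. by rewrite (le_trans _ (col_le_mxnorm1 v j))// big_ord1. Qed.

(** Since [v = v D A^-1 - v (D - A) A^-1] and [mxnorm1], which is the sup norm on
    row vectors, is submultiplicative. *)
Lemma mxnorm1_perturb n (A D : 'M[R]_n) (v : 'rV[R]_n) : A \in unitmx ->
  (1 - mxnorm1 (D - A) * mxnorm1 (invmx A)) * mxnorm1 v <=
  mxnorm1 (v *m D) * mxnorm1 (invmx A).
Proof.
move=> uA; rewrite mulrBl mul1r lerBlDr.
have {1}-> : v = v *m D *m invmx A - v *m (D - A) *m invmx A.
  by rewrite -mulmxBl -mulmxBr opprB addrC subrK mulmxK.
rewrite (le_trans (mxnorm1D _ _))// mxnorm1N lerD ?mxnorm1M//.
rewrite (le_trans (mxnorm1M _ _))// mulrAC ler_wpM2r ?mxnorm1_ge0//.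
by rewrite mulrC mxnorm1M.
Qed.

Lemma unitmx_perturb n (A D : 'M[R]_n) : A \in unitmx ->
  mxnorm1 (D - A) * mxnorm1 (invmx A) < 1 -> D \in unitmx.
Proof.
move=> uA s1; rewrite -row_free_unit; apply: inj_row_free => v vD.
have := mxnorm1_perturb D v uA; rewrite vD.
have -> : mxnorm1 (0 : 'rV[R]_n) = 0.
  apply/eqP; rewrite eq_le mxnorm1_ge0 andbT; apply: mxnorm1_le => // j.
  by rewrite big_ord1 mxE normr0.
rewrite mul0r pmulr_rle0 ?subr_gt0// => v0.
apply/rowP => j; rewrite mxE; apply/eqP; rewrite -normr_le0.
exact: le_trans (row_le_mxnorm1 v j) v0.
Qed.

(** * The columns of the harmonic matrix *)

Lemma col_index j : exists l k, (k < (2 * l).+1)%N /\ j = (l ^ 2 + k)%N.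
Proof.
elim: j => [|j [l [k [kl ->]]]]; first by exists 0%N, 0%N.
have [kl'|kl'] := ltnP k (2 * l); first by exists l, k.+1; rewrite addnS ltnS.
exists l.+1, 0%N; split=> //; nia.
Qed.

Lemma col_degP t (j : 'I_(t.+1 ^ 2)) :
  (col_deg j <= t)%N /\ (j - col_deg j ^ 2 < (2 * col_deg j).+1)%N.
Proof.
have [l [k [kl jE]]] := col_index j.
have := ltn_ord j; rewrite jE col_degE// addKn; split=> //.
by rewrite -ltnS -(ltn_exp2r _ _ (isT : 0 < 2)%N); lia.
Qed.

Lemma homog0E (p : poly3) : p \is homog 0 ->
  p = mpoly.mpolyC 3 (mpoly.mcoeff mpoly.mnm0 p).
Proof.
move=> hp; apply/mpoly.mpolyP => m; rewrite mpoly.mcoeffC.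
case: eqP => [->|/eqP m0]; first by rewrite mulr1.
rewrite mulr0; apply: (mpoly.dhomog_nemf_coeff hp).
by apply: contra m0 => /eqP h; rewrite -mpoly.mdeg_eq0; apply/eqP.
Qed.

Lemma homog_msize n (p : poly3) : p \is homog n -> (mpoly.msize p <= n.+1)%N.
Proof.
move=> /mpoly.dhomogP hp; rewrite mpoly.msizeE; apply/bigmax_leqP_seq => m /hp h _.
by rewrite -[X in (_ <= X.+1)%N]h.
Qed.

Section Basis.
Variable Y : nat -> nat -> point -> R.
Hypothesis hY : sph_harm_basis Y.

(** A choice of solid harmonic restricting to [Y l k]; the default value 0 only
    occurs for indices outside the basis. *)
Definition harm_poly l k : poly3 := xget 0 [set p : poly3 | solid_harmonic l p /\
  {in sphere, forall x, Y l k x = peval p x}].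

Lemma harm_polyP l k : (k < (2 * l).+1)%N -> solid_harmonic l (harm_poly l k) /\
  {in sphere, forall x, Y l k x = peval (harm_poly l k) x}.
Proof.
move=> kl; have [p [hp lp pE]] := shb_harmonic hY kl.
by rewrite /harm_poly; case: xgetP => [q -> //|/(_ p)] [].
Qed.

Lemma harm_poly_ortho l k l' k' : (k < (2 * l).+1)%N -> (k' < (2 * l').+1)%N ->
  poly_int (harm_poly l k * harm_poly l' k') = ((l == l') && (k == k'))%:R.
Proof.
move=> kl kl'; rewrite -(shb_orthonormal hY kl kl'); apply: eq_sphere_int => x xS.
by rewrite pevalM (harm_polyP kl).2// (harm_polyP kl').2.
Qed.

Lemma harm_poly_span l (h : poly3) : solid_harmonic l h ->
  exists a : 'I_(2 * l).+1 -> R,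
    {in sphere, forall x, peval h x = \sum_k a k * peval (harm_poly l k) x}.
Proof.
move=> [hh lh]; have [|a ha] := shb_span hY (l := l) (f := peval h); first by exists h.
exists a => x xS; rewrite ha//; apply: eq_bigr => k _.
by rewrite (harm_polyP (ltn_ord k)).2.
Qed.

(** [Y 0 0] is a constant, nonzero because it is normalized, so orthogonality to
    [Y 0 0] means having integral zero. *)
Lemma basis_mean_zero : harmonics_mean_zero.
Proof.
move=> n h /harm_poly_span[a ha].
have [[h00 _] _] := @harm_polyP 0 0 isT.
pose c := mpoly.mcoeff mpoly.mnm0 (harm_poly 0 0).
have cE p : poly_int (harm_poly 0 0 * p) = c * poly_int p.
  by rewrite (homog0E h00) -/c mpoly.mul_mpolyC linearZ.
have c0 : c != 0.
  apply/eqP => c0; have := @harm_poly_ortho 0 0 0 0 isT isT.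
  by rewrite cE c0 mul0r => /eqP; rewrite eq_sym oner_eq0.
rewrite (@eq_poly_int _ (\sum_k a k *: harm_poly n.+1 k)).
  rewrite raddf_sum big1// => k _; rewrite /= linearZ/=.
  apply/eqP; rewrite mulf_eq0; apply/orP; right.
  have := @harm_poly_ortho 0 0 n.+1 k isT (ltn_ord k).
  by rewrite cE => /eqP; rewrite mulf_eq0 (negbTE c0).
move=> x xS; rewrite ha// peval_sum; apply: eq_bigr => k _.
by rewrite pevalZ.
Qed.

Lemma harm_lipschitz l k x y : (k < (2 * l).+1)%N -> sphere x -> sphere y ->
  `|Y l k x - Y l k y| <=
  Num.sqrt ((l * l.+1)%N%:R * ((2 * l).+1%:R / (4 * pi))) * sdist x y.
Proof.
move=> kl hx hy; rewrite !(harm_polyP kl).2 ?inE//.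
have := @frame_lipschitz l 'I_(2 * l).+1 (fun k => harm_poly l k)
  basis_mean_zero (fun k => (harm_polyP (ltn_ord k)).1) _ _ (Ordinal kl) x y hx hy.
rewrite card_ord; apply => [i j|h hh]; last exact: harm_poly_span.
by rewrite harm_poly_ortho// eqxx.
Qed.

Variable t : nat.
Local Notation N := (t.+1 ^ 2)%N.

Definition harm_col (j : 'I_N) := Y (col_deg j) (j - col_deg j ^ 2)%N.

Lemma harm_col_lipschitz j x y : sphere x -> sphere y ->
  `|harm_col j x - harm_col j y| <=
  t.+1%:R * Num.sqrt ((2 * t + 1)%:R / (4 * pi)) * sdist x y.
Proof.
move=> hx hy; have [lt kl] := col_degP j.
apply: le_trans (harm_lipschitz kl hx hy) _.
rewrite ler_wpM2r//; first exact/acos_ge0/dotp_sphere_itv.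
rewrite -[X in X * Num.sqrt _]ger0_norm// -sqrtr_sqr -sqrtrM ?sqr_ge0//.
rewrite ler_wsqrtr// !mulrA ler_wpM2r ?invr_ge0 ?mulr_ge0 ?pi_ge0//.
rewrite -natrX -!natrM ler_nat leq_mul//; last by lia.
by rewrite -[leqRHS]mulnn leq_mul//; lia.
Qed.

Lemma harm_col_poly j : spherical_poly t (harm_col j).
Proof.
have [lt kl] := col_degP j; have [[hp _] pE] := harm_polyP kl.
exists (harm_poly (col_deg j) (j - col_deg j ^ 2)) => //.
exact: leq_trans (homog_msize hp) _.
Qed.

Definition in_harm_span (f : point -> R) := exists a : 'I_N -> R,
  {in sphere, forall x, f x = \sum_j a j * harm_col j x}.

Lemma in_harm_span_sum (I : Type) (s : seq I) (b : I -> R) (F : I -> point -> R) f :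
  (forall i, in_harm_span (F i)) ->
  {in sphere, forall x, f x = \sum_(i <- s) b i * F i x} -> in_harm_span f.
Proof.
move=> /choice[a ha] fE; exists (fun j => \sum_(i <- s) b i * a i j) => x xS.
rewrite fE//; under [RHS]eq_bigr do rewrite mulr_suml.
rewrite exchange_big; apply: eq_bigr => i _ /=; rewrite ha// mulr_sumr.
by apply: eq_bigr => j _; rewrite mulrA.
Qed.

Lemma in_harm_span_basis l k : (l <= t)%N -> (k < (2 * l).+1)%N -> in_harm_span (Y l k).
Proof.
move=> lt kl; have jN : (l ^ 2 + k < N)%N by nia.
exists (fun j => (j == Ordinal jN)%:R) => x _.
rewrite (bigD1 (Ordinal jN))//= eqxx mul1r big1 ?addr0 => [|j /negbTE->].
  by rewrite /harm_col /= col_degE// addKn.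
exact: mul0r.
Qed.

(** Monomials are homogeneous, and the factors [sqnorm ^+ j] of their Fischer
    decompositions are 1 on the sphere. *)
Lemma spherical_poly_span f : spherical_poly t f -> in_harm_span f.
Proof.
move=> [p pt fE].
have hom n q : (n <= t)%N -> q \is homog n -> in_harm_span (peval q).
  move=> nt /fischer[h hh qE].
  (* components beyond the degree are unconstrained: replace them by 0 *)
  pose h' j := if (2 * j <= n)%N then h j else 0.
  apply: (@in_harm_span_sum _ (index_enum 'I_(n./2.+1)) (fun=> 1)
    (fun j => peval (h' j))).
    move=> j; rewrite /h'; case: leqP => [jn|_].
      have [a ha] := harm_poly_span (hh j jn).
      apply: (@in_harm_span_sum _ (index_enum 'I_((2 * (n - 2 * j)).+1)) a
        (fun k => Y (n - 2 * j) k)).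
        by move=> k; apply: in_harm_span_basis => //; lia.
      move=> x xS; rewrite ha//; apply: eq_bigr => k _.
      by rewrite (harm_polyP (ltn_ord k)).2.
    by exists (fun=> 0) => x _; rewrite peval0 big1// => i _; rewrite mul0r.
  move=> x /set_mem xS; rewrite qE peval_sum; apply: eq_bigr => j _.
  by rewrite peval_sqnormXM// mul1r /h' ifT//; have := ltn_ord j; lia.
pose q m : poly3 := if m \in mpoly.msupp p then mpoly.mpolyX R m else 0.
apply: (@in_harm_span_sum _ (mpoly.msupp p) (fun m => mpoly.mcoeff m p)
  (fun m => peval (q m))).
  move=> m; rewrite /q; case: ifPn => [mp|_].
    apply: (hom (mpoly.mdeg m)); last by rewrite mpoly.dhomogX.
    by rewrite -ltnS (leq_trans (mpoly.msize_mdeg_lt mp)).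
  by exists (fun=> 0) => x _; rewrite peval0 big1// => i _; rewrite mul0r.
move=> x xS; rewrite fE// {1}(mpoly.mpolyE p) peval_sum; apply: eq_big_seq => m mp.
by rewrite pevalZ /q mp.
Qed.

Lemma sphere_int_harm_span (a : 'I_N -> R) f :
  {in sphere, forall x, f x = \sum_j a j * harm_col j x} ->
  sphere_int f = \sum_j a j * sphere_int (harm_col j).
Proof.
move=> fE; have kl (j : 'I_N) := (col_degP j).2.
pose q (j : 'I_N) := harm_poly (col_deg j) (j - col_deg j ^ 2)%N.
have qE j : sphere_int (harm_col j) = poly_int (q j).
  by apply: eq_sphere_int => x xS; exact: (harm_polyP (kl j)).2.
transitivity (poly_int (\sum_j a j *: q j)).
  apply: eq_sphere_int => x xS; rewrite fE// peval_sum; apply: eq_bigr => j _.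
  by rewrite pevalZ /harm_col (harm_polyP (kl j)).2.
by rewrite raddf_sum; apply: eq_bigr => j _ /=; rewrite linearZ qE.
Qed.

Lemma harm_mx_perturb (X Z : 'I_N -> point) r : 0 <= r ->
  (forall i, sphere (X i)) -> (forall i, sphere (Z i)) ->
  (forall i, sdist (X i) (Z i) <= r) ->
  mxnorm1 (harm_mx Y t X - harm_mx Y t Z) <=
  Num.sqrt ((2 * t + 1)%:R / (4 * pi)) * t.+1%:R ^+ 3 * r.
Proof.
move=> r0 hX hZ XZ; apply: mxnorm1_le => [|j].
  by rewrite !mulr_ge0// ?sqrtr_ge0// exprn_ge0.
apply: (@le_trans _ _
  (\sum_(i < N) (t.+1%:R * Num.sqrt ((2 * t + 1)%:R / (4 * pi)) * r))).
  apply: ler_sum => i _; rewrite !mxE (le_trans (harm_col_lipschitz _ _ _))//.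
  by rewrite ler_wpM2l// mulr_ge0// sqrtr_ge0.
rewrite sumr_const card_ord -[leLHS]mulr_natr natrX le_eqVlt; apply/orP; left; apply/eqP.
ring.
Qed.

End Basis.
End SphericalHarmonics.

(** * The perturbed design *)

Theorem theorem8 (R : realType) (Y : nat -> nat -> 'rV[R]_3 -> R)
    (hY : sph_harm_basis Y)
    (t : nat) (ht : (1 <= t)%N)
    (c : 'I_(t.+1 ^ 2)%N -> 'rV[R]_3) (g : 'I_(t.+1 ^ 2)%N -> R)
    (hc : point_set c) (hg : forall i, 0 < g i)
    (hdesign : exists X0 : 'I_(t.+1 ^ 2)%N -> 'rV[R]_3,
        [/\ point_set X0, in_caps c g X0 & spherical_design t X0])
    (hns : harm_mx Y t c \in unitmx)
    (eps : R) (heps : 0 <= eps < 1) :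
  let tau : R := Num.sqrt ((2 * t + 1)%:R / (4 * pi)) * (t.+1)%:R ^+ 3 in
  let K : R := mxnorm1 (invmx (harm_mx Y t c)) in
  caps_rad g < Num.min (caps_sep c g / 4) (eps / (2 * (1 + 2 * eps) * tau * K)) ->
  forall X : 'I_(t.+1 ^ 2)%N -> 'rV[R]_3, point_set X -> in_caps c g X ->
    [/\ fundamental t X, spherical_eps_design t eps X &
        2 * tau * caps_rad g * K / (1 - 4 * tau * caps_rad g * K) <= eps < 1].
Proof.
move=> tau K; rewrite lt_min => /andP[_ r_lt] X [sX _] capX.
have [X0 [[sX0 _] capX0 designX0]] := hdesign.
have [sc _] := hc; have /andP[eps0 eps1] := heps.
set r := caps_rad g in r_lt *.
pose N := (t.+1 ^ 2)%N.
have N0 : (0 < N)%N by rewrite expn_gt0.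
have g_le i : g i <= r by exact: (le_bigmax _ g).
have r0 : 0 < r by exact: lt_le_trans (hg (Ordinal N0)) (g_le _).
have pi0 := pi_gt0 R.
have tau0 : 0 < tau.
  by rewrite mulr_gt0 ?exprn_gt0// sqrtr_gt0 divr_gt0 ?mulr_gt0// ltr0n addn1.
(* if [K] were 0, the bound on [r] would be a division by zero, that is 0 *)
have K0 : 0 < K.
  rewrite lt_neqAle mxnorm1_ge0 andbT; apply: contraTneq r_lt => <-.
  by rewrite mulr0 invr0 mulr0 -leNgt ltW.
pose s := tau * r * K.
have s0 : 0 < s := mulr_gt0 (mulr_gt0 tau0 r0) K0.
have s_eps : 2 * s * (1 + 2 * eps) < eps.
  have den0 : 0 < 2 * (1 + 2 * eps) by lra.
  move: r_lt; rewrite ltr_pdivlMr; last exact: mulr_gt0 (mulr_gt0 den0 tau0) K0.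
  by apply: le_lt_trans; rewrite /s le_eqVlt; apply/orP; left; apply/eqP; ring.
have s_eps' : 2 * s < eps * (1 - 4 * s) by lra.
have s4 : 0 < 1 - 4 * s.
  have : 0 < eps * (1 - 4 * s) by lra.
  by rewrite pmulr_rgt0// lt_neqAle eps0 andbT; apply: contraTneq s_eps => <-; lra.
have dist_le (Z : 'I_N -> 'rV[R]_3) : in_caps c g Z -> forall i, sdist (Z i) (c i) <= r.
  by move=> capZ i; have [[_ /le_trans->]] := capZ i.
pose A := harm_mx Y t c; pose D := harm_mx Y t X.
have DA : mxnorm1 (D - A) <= tau * r.
  by apply: harm_mx_perturb => //; [exact: ltW|exact: dist_le].
have X0A : mxnorm1 (harm_mx Y t X0 - A) <= tau * r.
  by apply: harm_mx_perturb => //; [exact: ltW|exact: dist_le].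
have DAK : mxnorm1 (D - A) * K <= s by rewrite ler_wpM2r// ltW.
have uD : D \in unitmx by apply: (unitmx_perturb hns); rewrite -/K; lra.
split; last first.
- have sE a : a * tau * r * K = a * s by rewrite /s !mulrA.
  by rewrite eps1 andbT !sE ler_pdivrMr// ltW.
- pose e := 4 * pi / N%:R : R.
  have e0 : 0 < e by rewrite divr_gt0 ?mulr_gt0// ltr0n.
  pose b : 'rV[R]_N := \row_j sphere_int (harm_col Y j).
  pose w := b *m invmx D; pose v := w - const_mx e.
  (* each column is a spherical polynomial, which the design [X0] integrates *)
  have bE : b = const_mx e *m harm_mx Y t X0.
    apply/rowP => j; rewrite !mxE.
    have := designX0 _ (harm_col_poly hY j).
    move=> /(congr1 ( *%R (4 * pi))).
    rewrite mulVKf ?mulf_neq0 ?pnatr_eq0 ?gt_eqF// => <-.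
    by rewrite mulrA -/e mulr_sumr; apply: eq_bigr => i _; rewrite !mxE.
  have vD : v *m D = const_mx e *m (harm_mx Y t X0 - D).
    by rewrite mulmxBl mulmxKV// bE mulmxBr.
  have e1 : mxnorm1 (const_mx e : 'rV[R]_N) <= e.
    by apply: mxnorm1_le => [|j]; [exact: ltW|rewrite big_ord1 mxE gtr0_norm].
  (* [X] and [X0] are compared through the centers, whence the factor 2 *)
  have vDle : mxnorm1 (v *m D) <= e * (2 * (tau * r)).
    rewrite vD (le_trans (mxnorm1M _ _))// ler_pM ?mxnorm1_ge0//.
    rewrite -(subrKA A) (le_trans (mxnorm1D _ _))//.
    by rewrite -[A - D]opprB mxnorm1N mulr2n mulrDl mul1r lerD.
  have vle : mxnorm1 v <= e * eps.
    have := mxnorm1_perturb D v hns; rewrite -/K => pert.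
    have v0 := mxnorm1_ge0 v.
    have h1 : (1 - s) * mxnorm1 v <= e * (2 * s).
      apply: (@le_trans _ _ ((1 - mxnorm1 (D - A) * K) * mxnorm1 v)).
        by rewrite ler_wpM2r// lerB.
      apply: le_trans pert _.
      rewrite (_ : e * (2 * s) = e * (2 * (tau * r)) * K); last by rewrite /s !mulrA.
      by rewrite ler_wpM2r// ltW.
    have s1 : 0 < 1 - s by lra.
    have es : 0 <= eps * s by rewrite mulr_ge0// ltW.
    rewrite -(ler_pM2l s1) (le_trans h1)// [leRHS]mulrCA ler_pM2l//; lra.
  have wle i : `|w 0 i - e| <= e * eps.
    by apply: le_trans vle; have := row_le_mxnorm1 v i; rewrite !mxE.
  exists (fun i => w 0 i); split=> [i|f /(spherical_poly_span hY)[a fE]].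
    move: (wle i); rewrite ler_distl => /andP[w1 w2].
    apply/andP; split; first by rewrite -/N -/e; lra.
    rewrite -/N -/e (le_trans w2)// -[X in X + _]mulr1 -mulrDr ler_pM2l//.
    (* [1 + eps <= (1 - eps)^-1], as [(1 + eps) (1 - eps) <= 1] *)
    by rewrite -div1r ler_pdivlMr; nra.
  rewrite (sphere_int_harm_span hY fE).
  under eq_bigr => i _ do rewrite fE ?inE// mulr_sumr.
  rewrite exchange_big; apply: eq_bigr => j _ /=.
  have -> : sphere_int (harm_col Y j) = (w *m D) 0 j by rewrite mulmxKV// mxE.
  rewrite [(w *m D) 0 j]mxE mulr_sumr; apply: eq_bigr => i _.
  by rewrite [D i j]mxE mulrCA.
- move=> f /(spherical_poly_span hY)[a fE] fX x xS.
  pose u : 'cV[R]_N := \col_j a j.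
  have Du : D *m u = 0.
    apply/colP => i; transitivity (f (X i)); last by rewrite fX mxE.
    rewrite fE ?inE// mxE.
    by apply: eq_bigr => j _; rewrite !mxE mulrC.
  have u0 : u = 0 by rewrite -(mulKmx uD u) Du mulmx0.
  rewrite fE// big1// => j _; have /colP/(_ j) := u0.
  by rewrite !mxE => ->; rewrite mul0r.
Qed.
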